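(* For any lattice $\mathcal{L} \subset \mathbb{R}^n$ and any two vectors $\mathbf{x}, \mathbf{y} \in \mathbb{R}^n$, we have \[ \rho(\mathcal{L} + \mathbf{x})^2 \, \rho(\mathcal{L} + \mathbf{y})^2 \leq \rho(\mathcal{L})^2 \, \rho(\mathcal{L} + \mathbf{x} + \mathbf{y}) \, \rho(\mathcal{L} + \mathbf{x} - \mathbf{y}) . \]
   Context: A lattice $\mathcal{L}\subset\mathbb{R}^n$ is the set of all integer linear combinations of $n$ linearly independent vectors of $\mathbb{R}^n$. For $\mathbf{x}\in\mathbb{R}^n$, $\rho(\mathbf{x}) = \exp(-\pi \|\mathbf{x}\|^2)$ with $\|\cdot\|$ the Euclidean norm, and for a discrete set $A\subset\mathbb{R}^n$, $\rho(A) = \sum_{\mathbf{w}\in A}\rho(\mathbf{w})$. $\mathcal{L}+\mathbf{x} = \{\mathbf{v}+\mathbf{x} : \mathbf{v}\in\mathcal{L}\}$. *)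

(* Defs.v *)
From HB Require Import structures.
From mathcomp Require Import all_boot all_order all_algebra.
From mathcomp Require Import all_classical all_reals all_analysis.

Set Implicit Arguments.
Unset Strict Implicit.
Unset Printing Implicit Defensive.

Import Order.TTheory GRing.Theory Num.Theory.

Local Open Scope classical_set_scope.
Local Open Scope ring_scope.

Definition is_lattice (R : realType) (n : nat) (L : set 'rV[R]_n) : Prop :=
  exists b : n.-tuple 'rV[R]_n,
    free b /\
    L = [set v | exists z : 'I_n -> int, v = \sum_(i < n) tnth b i *~ z i].

(* The norm `|x| that the library puts on 'rV[R]_n is the sup norm. *)
Definition eucl_norm (R : realType) (n : nat) (x : 'rV[R]_n) : R :=
  Num.sqrt (\sum_(i < n) x ord0 i ^+ 2).

Definition rho (R : realType) (n : nat) (x : 'rV[R]_n) : R :=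
  expR (- (pi * eucl_norm x ^+ 2)).

(* The terms are positive, so the sum always makes sense in [0, +oo]; it is
   finite when A is a translate of a lattice. *)
Definition rho_set (R : realType) (n : nat) (A : set 'rV[R]_n) : \bar R :=
  (\esum_(w in A) (rho w)%:E)%E.

Definition translate (R : realType) (n : nat) (L : set 'rV[R]_n)
    (x : 'rV[R]_n) : set 'rV[R]_n :=
  [set v + x | v in L].

(* Main.v *)
(** The substitution v = p + q + c, w = p - q, with c running over a set C of
    representatives of L / 2L, parametrises L x L by C x L x L.  By the
    parallelogram law it turns the product rho(L + x) rho(L + y) into
    [sum_(c in C) F_c(x + y) F_c(x - y)], where F_c(t) is the mass of
    2L + c + t under exp(-pi |.|^2 / 2).  Taking y = 0 gives
    [sum_(c in C) F_c(t)^2 = rho(L) rho(L + t)], so that the theorem is the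
    Cauchy-Schwarz inequality over C.  All sums have nonnegative terms, so
    they can be handled in [0, +oo] without proving convergence. *)
Require Import Defs.
From HB Require Import structures.
From mathcomp Require Import all_boot all_order all_algebra.
From mathcomp Require Import all_classical all_reals all_analysis.
From mathcomp Require Import ring lra.

Import Order.TTheory GRing.Theory Num.Theory.

Local Open Scope classical_set_scope.
Local Open Scope ring_scope.

Section ExtendedSums.
Local Open Scope ereal_scope.
Context {R : realType}.

(** For a finite positive [k] the converse of [le] is [le] applied to the factor [k^-1]. The value
    [+oo] is allowed because [ge0_esumM] takes whole sums, possibly infinite, as factors. *)
Lemma ge0_esumZl {T : choiceType} (I : set T) (k : \bar R) (a : T -> \bar R) :
  0 <= k -> (forall i, 0 <= a i) ->
  \esum_(i in I) (k * a i) = k * \esum_(i in I) a i.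
Proof.
have le (l : \bar R) (b : T -> \bar R) : 0 <= l -> (forall i, 0 <= b i) ->
    \esum_(i in I) (l * b i) <= l * \esum_(i in I) b i.
  move=> l0 b0; apply: ge_ereal_sup => _ [X [finX XI] <-].
  rewrite -ge0_mule_fsumr// lee_wpmul2l// esum_ge//.
  by exists X.
move=> k0 a0; apply/eqP; rewrite eq_le le//=.
case: k k0 => [r| |//] k0.
- have := k0; rewrite lee_fin le0r => /orP[/eqP->|r0].
    by rewrite mul0e esum_ge0// => i _; rewrite mul0e.
  rewrite -lee_pdivlMl//.
  have -> : \esum_(i in I) a i = \esum_(i in I) (r^-1%:E * (r%:E * a i)).
    by apply: eq_esum => i _; rewrite muleA -EFinM mulVf ?gt_eqF// mul1e.
  by apply: le => [|i]; rewrite ?mule_ge0// lee_fin invr_ge0 ltW.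
(* For [k = +oo], one nonzero term already makes the sum of products infinite; otherwise both sides
   vanish. *)
- have [[i Ii ai0]|aI0] := pselect (exists2 i, I i & a i != 0).
    suff -> : \esum_(i in I) (+oo * a i) = +oo by rewrite leey.
    apply/eqP; rewrite -leye_eq esum_ge//.
    exists [set i]; first by split; [exact: finite_set1|move=> _ ->].
    by rewrite fsbig_set1 gt0_mulye// lt_neqAle eq_sym ai0 a0.
  rewrite [X in +oo * X]esum1 ?mule0 ?esum_ge0// => i Ii.
    by rewrite mule_ge0.
  by apply/eqP/negP => /negP ai0; apply: aI0; exists i.
Qed.

Lemma ge0_esumM {T U : choiceType} (I : set T) (J : set U)
    (a : T -> \bar R) (b : U -> \bar R) :
  (forall i, 0 <= a i) -> (forall j, 0 <= b j) ->
  (\esum_(i in I) a i) * (\esum_(j in J) b j) =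
  \esum_(i in I) \esum_(j in J) (a i * b j).
Proof.
move=> a0 b0; rewrite muleC -ge0_esumZl ?esum_ge0//.
by apply: eq_esum => i _; rewrite ge0_esumZl// muleC.
Qed.

Lemma ge0_AMGM2 (u v : \bar R) : 0 <= u -> 0 <= v ->
  u * v + u * v <= u ^+ 2 + v ^+ 2.
Proof.
have sqy : (+oo : \bar R) ^+ 2 = +oo by rewrite expe2 mulyy.
case: u => [u| |//] u0; case: v => [v| |//] v0;
  rewrite ?sqy ?addye ?addey ?leey//.
rewrite !expe2 -!EFinM -!EFinD lee_fin.
have := sqr_ge0 (u - v)%R; rewrite -!expr2; lra.
Qed.

(** Doubling and expanding into sums over pairs reduces this to AM-GM for [F i * G j] and
    [G i * F j]. No root, quotient or difference of sums occurs, so infinite values are harmless. *)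
Lemma esum_CauchySchwarz {T : choiceType} (I : set T) (F G : T -> \bar R) :
  (forall i, 0 <= F i) -> (forall i, 0 <= G i) ->
  (\esum_(i in I) (F i * G i)) ^+ 2 <=
  (\esum_(i in I) F i ^+ 2) * (\esum_(i in I) G i ^+ 2).
Proof.
move=> F0 G0.
have FG0 i j : 0 <= F i * G j by rewrite mule_ge0.
have F20 i : 0 <= F i ^+ 2 by rewrite expe_ge0.
have G20 i : 0 <= G i ^+ 2 by rewrite expe_ge0.
rewrite -(@lee_pmul2l _ 2%:E)// [leLHS]mule_natl [leRHS]mule_natl !mule2n.
(* Swapping the factors of the second copy gives it the terms [G i ^+ 2 * F j ^+ 2]. *)
rewrite [X in _ <= _ + X]muleC expe2 !ge0_esumM//.
rewrite -!esumD; try by move=> i _; apply: esum_ge0 => j _; rewrite mule_ge0.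
apply: le_esum => i _.
rewrite -!esumD; try by move=> j _; rewrite mule_ge0.
apply: le_esum => j _.
rewrite muleACA (muleC (G i)) -muleACA (muleC (F j)).
have sqM (u v : \bar R) : u ^+ 2 * v ^+ 2 = (u * v) ^+ 2.
  by rewrite !expe2 muleACA.
by rewrite !sqM ge0_AMGM2// mule_ge0.
Qed.

End ExtendedSums.

Section Lattices.
Context {R : realType} {n : nat}.
Implicit Types (L : set 'rV[R]_n) (x y t : 'rV[R]_n).

Lemma is_lattice_closed L : is_lattice L ->
  [/\ L 0, forall v w, L v -> L w -> L (v - w) &
    forall v w, L v -> L w -> L (v + w)].
Proof.
move=> [b [_ ->]]; split => [|v w [z ->] [z' ->]|v w [z ->] [z' ->]].
- by exists (fun=> 0); rewrite big1// => i _; rewrite mulr0z.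
- exists (fun i => z i - z' i); rewrite -sumrB.
  by apply: eq_bigr => i _; rewrite mulrzBr.
- exists (fun i => z i + z' i); rewrite -big_split.
  by apply: eq_bigr => i _; rewrite mulrzDr.
Qed.

Lemma is_lattice_half_transversal L : is_lattice L ->
  exists C : set 'rV[R]_n, [/\ C `<=` L,
    forall u, L u -> exists c p, [/\ C c, L p & u = p + p + c] &
    forall c d p, C c -> C d -> L p -> c - d = p + p -> c = d].
Proof.
move=> /is_lattice_closed[L0 LB LD].
pose coset u := [set c | L c /\ exists2 p, L p & u - c = p + p].
have coset_sub u v m : L m -> v - u = m + m -> coset u `<=` coset v.
  move=> Lm e c [Lc [s Ls es]]; split=> //; exists (s + m); first exact: LD.
  by rewrite addrACA -es -e addrC addrA subrK.
(* The choice depends only on the coset as a set, so congruent vectors get the same representative.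
   The default 0 is not reached for [u] in [L], since [u] lies in [coset u]. *)
pose rep u := xget 0 (coset u).
have repP u : L u -> coset u (rep u).
  move=> Lu; apply: xgetPex; exists u; split=> //.
  by exists 0; rewrite // subrr addr0.
exists (rep @` L); split.
- by move=> _ [u Lu <-]; have [] := repP u Lu.
- move=> u Lu; have [_ [p Lp e]] := repP u Lu.
  by exists (rep u), p; split; [exists u| |rewrite -e subrK].
- move=> _ _ p [u Lu <-] [v Lv <-] Lp e.
  have [_ [q Lq eq]] := repP u Lu; have [_ [r Lr er]] := repP v Lv.
  have uv : u - v = (q + p - r) + (q + p - r).
    have -> : u = q + q + rep u by rewrite -eq subrK.
    have -> : v = r + r + rep v by rewrite -er subrK.
    have -> : rep u = p + p + rep v by rewrite -e subrK.
    by apply/rowP => i; rewrite !mxE; ring.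
  have Lm : L (q + p - r) by apply: (LB) => //; exact: LD.
  congr xget; apply/seteqP; split; last exact: (coset_sub _ _ (q + p - r)).
  apply: (coset_sub _ _ (- (q + p - r))); last by rewrite -opprB uv opprD.
  by rewrite -sub0r; exact: LB.
Qed.

Lemma is_lattice_pair_bij L : is_lattice L -> exists C : set 'rV[R]_n,
  set_bij (C `*` (L `*` L)) (L `*` L)
    (fun k => (k.2.1 + k.2.2 + k.1, k.2.1 - k.2.2)).
Proof.
move=> hL; have [_ LB LD] := is_lattice_closed _ hL.
have [C [CL Cex Cuniq]] := is_lattice_half_transversal _ hL.
exists C; split.
- move=> [c [p q]] [/= Cc [Lp Lq]]; split=> /=; last exact: (LB _ _ Lp Lq).
  exact: (LD _ _ (LD _ _ Lp Lq) (CL _ Cc)).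
- suff inj (c p q d p' q' : 'rV[R]_n) : C c -> L p -> C d -> L p' ->
      p + q + c = p' + q' + d -> p - q = p' - q' -> [/\ c = d, p = p' & q = q'].
    move=> [c [p q]] [d [p' q']] /[!inE] -[/= Cc [Lp _]] [/= Cd [Lp' _]].
    move=> [e1 e2].
    by have [-> -> ->] := inj _ _ _ _ _ _ Cc Lp Cd Lp' e1 e2.
  move=> Cc Lp Cd Lp' e1 e2.
  (* Eliminating [q] leaves [c - d = 2 (p' - p)], which forces [c = d]. *)
  have qE : q = p - (p' - q') by rewrite -e2 subKr.
  have cd : c = d.
    apply: (Cuniq _ _ (p' - p)) => //; first exact: (LB _ _ Lp' Lp).
    have -> : c = (p' + q' + d) - (p + q) by rewrite -e1 addrAC subrr add0r.
    by rewrite qE; apply/rowP => i; rewrite !mxE; ring.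
  have pp : p = p'.
    move: e1; rewrite cd => /addIr; rewrite qE => /rowP e1.
    by apply/rowP => i; move: (e1 i); rewrite !mxE; lra.
  by split=> //; rewrite qE pp subKr.
(* Surjectivity: since [v + w = 2 p + q + c - q] must hold, [p] and [c] come from decomposing
   [v + w], and then [q = p - w]. *)
- move=> [v w] [/= Lv Lw]; have [c [p [Cc Lp e]]] := Cex _ (LD _ _ Lv Lw).
  exists (c, (p, p - w)).
    by split=> //; split=> //; exact: (LB _ _ Lp Lw).
  congr pair; last by rewrite /= subKr.
  by rewrite /= -[v](addrK w) e; apply/rowP => i; rewrite !mxE; ring.
Qed.

Lemma eucl_norm_sqr x : eucl_norm x ^+ 2 = \sum_(i < n) x ord0 i ^+ 2.
Proof. by rewrite sqr_sqrtr// sumr_ge0// => i _; exact: sqr_ge0. Qed.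

(** The halved exponent absorbs the factor 2 of the parallelogram law. *)
Definition wide_rho x : R := expR (- (pi * eucl_norm x ^+ 2) / 2).

Lemma rho_mul_parallelogram x y :
  rho x * rho y = wide_rho (x + y) * wide_rho (x - y).
Proof.
rewrite /rho /wide_rho -!expRD; congr expR.
have -> : eucl_norm (x + y) ^+ 2 =
    2 * (eucl_norm x ^+ 2 + eucl_norm y ^+ 2) - eucl_norm (x - y) ^+ 2.
  rewrite !eucl_norm_sqr -big_split/= mulr_sumr -sumrB.
  by apply: eq_bigr => i _; rewrite !mxE; ring.
by field.
Qed.

Local Open Scope ereal_scope.

Lemma rho_set_translate L x :
  rho_set (translate L x) = \esum_(v in L) (rho (v + x))%:E.
Proof.
by rewrite /rho_set /translate esum_image// => v w _ _; exact: addIr.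
Qed.

(** The coset [2L + t], indexed by [L] itself. *)
Definition wide_mass L t : \bar R := \esum_(p in L) (wide_rho (p + p + t))%:E.

Lemma wide_mass_ge0 L t : 0 <= wide_mass L t.
Proof. by apply: esum_ge0 => v _; rewrite lee_fin expR_ge0. Qed.

(** The set [C] is chosen before [x] and [y], so that instances at different shifts can be compared
    term by term. *)
Lemma rho_set_mul L : is_lattice L -> exists C : set 'rV[R]_n,
  forall x y, rho_set (translate L x) * rho_set (translate L y) =
    \esum_(c in C) (wide_mass L (c + (x + y)) * wide_mass L (c + (x - y))).
Proof.
move=> hL; have [C Cbij] := is_lattice_pair_bij _ hL.
exists C => x y.
have rho0 (v : 'rV[R]_n) : 0 <= (rho v)%:E by rewrite lee_fin expR_ge0.
have wide0 v : 0 <= (wide_rho v)%:E by rewrite lee_fin expR_ge0.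
rewrite !rho_set_translate ge0_esumM// esum_esum;
  last by move=> *; rewrite mule_ge0.
rewrite (reindex_esum _ _ _ _ Cbij).
rewrite -(esum_esum (J := fun=> L `*` L)
  (a := fun c k => (rho (k.1 + k.2 + c + x))%:E * (rho (k.1 - k.2 + y))%:E)).
  2: by move=> *; rewrite mule_ge0.
apply: eq_esum => c _.
rewrite /wide_mass ge0_esumM// esum_esum;
  last by move=> *; rewrite mule_ge0.
(* The two arguments have sum [2p + c + (x + y)] and difference [2q + c + (x - y)], which separates
   [p] from [q]. *)
apply: eq_esum => -[p q] _ /=; rewrite -!EFinM rho_mul_parallelogram.
by congr (_ * _)%:E; congr wide_rho; apply/rowP => i; rewrite !mxE; ring.
Qed.

End Lattices.

Theorem theorem2p1 (R : realType) (n : nat) (L : set 'rV[R]_n)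
    (hL : is_lattice L) (x y : 'rV[R]_n) :
  (rho_set (translate L x) ^+ 2 * rho_set (translate L y) ^+ 2 <=
   rho_set L ^+ 2 * rho_set (translate L (x + y))
     * rho_set (translate L (x - y)))%E.
Proof.
have [C mulE] := rho_set_mul _ hL.
have L0 : translate L 0 = L.
  by rewrite /translate; under eq_imagel do rewrite addr0; rewrite image_id.
have sqE t : (\esum_(c in C) wide_mass L (c + t) ^+ 2 =
    rho_set L * rho_set (translate L t))%E.
  by have := mulE t 0; rewrite L0 addr0 subr0 muleC => ->.
(* The left side becomes the square of one sum over [C]; [sqE] at [x + y] and at [x - y] evaluates
   the two sums of squares. *)
rewrite !expe2 muleACA mulE -expe2.
apply: le_trans (esum_CauchySchwarz _ _ _ _ _) _ => [c|c|];
  rewrite ?wide_mass_ge0//.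
by rewrite [X in (X * _ <= _)%E]sqE [X in (_ * X <= _)%E]sqE
  muleACA muleA.
Qed.
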